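(* Let $\Omega_1\subset\mathbb{R}^{d_1}$ and $\Omega_2\subset\mathbb{R}^{d_2}$ be compact domains, $\Omega=\Omega_1\times\Omega_2$, $c\in L^2(\Omega)$, $\gamma>0$, and let $\mu_i:\Omega_i\to\mathbb{R}$, $i=1,2$, be measurable functions. Consider the problem $$\min_{\pi\in L^2(\Omega)}\ \int_\Omega c\,\pi\,\mathrm{d}\lambda+\tfrac{\gamma}{2}\|\pi\|_{L^2(\Omega)}^2$$ subject to $$\int_{\Omega_2}\pi(x_1,x_2)\,\mathrm{d}\lambda_2=\mu_1(x_1),\qquad \int_{\Omega_1}\pi(x_1,x_2)\,\mathrm{d}\lambda_1=\mu_2(x_2),\qquad \pi(x_1,x_2)\ge 0,$$ where the constraints are understood pointwise almost everywhere. This problem has an optimal solution if and only if $\mu_1\in L^2(\Omega_1)$, $\mu_2\in L^2(\Omega_2)$, $\mu_1,\mu_2\ge 0$ almost everywhere, and $\int_{\Omega_1}\mu_1\,\mathrm{d}\lambda_1=\int_{\Omega_2}\mu_2\,\mathrm{d}\lambda_2$.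
   Context: $\lambda_1,\lambda_2,\lambda$ denote Lebesgue measure on $\Omega_1,\Omega_2,\Omega$ respectively. A compact domain is understood as a compact set of positive Lebesgue measure. An optimal solution is a feasible $\pi\in L^2(\Omega)$ attaining the minimum. *)

(* Defs.v *)
From HB Require Import structures.
From mathcomp Require Import all_boot all_order all_algebra.
From mathcomp Require Import all_classical all_reals all_analysis.
From mathcomp Require Import lra.

Set Implicit Arguments.
Unset Strict Implicit.
Unset Printing Implicit Defensive.

Import Order.TTheory GRing.Theory Num.Theory.
Import numFieldNormedType.Exports.

Local Open Scope classical_set_scope.
Local Open Scope ring_scope.

Section lebesgue_Rn.
Context {R : realType} {n : nat}.
Implicit Types (a b x : 'rV[R]_n) (X Y : set 'rV[R]_n).
Implicit Types B : option ('rV[R]_n * 'rV[R]_n).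

(* [Some (a, b)] is the half-open box of the x with a_i < x_i <= b_i for all i;
   [None] is the empty set. It is needed only for n = 0, where the box of
   [Some (a, b)] is never empty. *)
Definition box B : set 'rV[R]_n :=
  if B is Some (a, b) then [set x | forall i, a 0 i < x 0 i <= b 0 i]
  else set0.

Definition volume B : R :=
  if B is Some (a, b) then \prod_(i < n) Num.max 0 (b 0 i - a 0 i) else 0.

Definition lebesgue_outer X : \bar R :=
  ereal_inf [set (\sum_(k <oo) (volume (B k))%:E)%E |
    B in [set B : nat -> option ('rV[R]_n * 'rV[R]_n) |
           X `<=` \bigcup_k box (B k)]].

Local Open Scope ereal_scope.

Lemma volume_ge0 B : (0 <= volume B)%R.
Proof.
case: B => [[a b]|] //=; apply: prodr_ge0 => i _.
by rewrite le_max lexx.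
Qed.

Let evolume_ge0 B : 0 <= (volume B)%:E.
Proof. by rewrite lee_fin volume_ge0. Qed.

Lemma lebesgue_outer_ge0 X : 0 <= lebesgue_outer X.
Proof.
by apply: le_ereal_inf_tmp => _ [B _ <-]; apply: nneseries_ge0 => k _ _.
Qed.

Lemma lebesgue_outer0 : lebesgue_outer set0 = 0.
Proof.
apply/eqP; rewrite eq_le lebesgue_outer_ge0 andbT.
apply: ereal_inf_lbound; exists (fun=> None) => //=.
by rewrite eseries0.
Qed.

Lemma le_lebesgue_outer : {homo lebesgue_outer : X Y / X `<=` Y >-> X <= Y}.
Proof.
move=> X Y XY; apply/ereal_inf_le_tmp => _ [B YB <-].
by exists B => //; exact: subset_trans YB.
Qed.

Lemma lebesgue_outer_sigma_subadditive : sigma_subadditive lebesgue_outer.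
Proof.
move=> A; have [[i ioo]|] := pselect (exists i, lebesgue_outer (A i) = +oo).
  rewrite (eseries_pinfty _ _ ioo) ?leey// => m _.
  by rewrite -ltNye (lt_le_trans _ (lebesgue_outer_ge0 _)).
rewrite -forallNE => Aoo.
apply/lee_addgt0Pr => e e0.
rewrite (le_trans _ (epsilon_trick _ _ (ltW e0)))//; last first.
  by move=> m; exact: lebesgue_outer_ge0.
pose P m (B : nat -> option ('rV[R]_n * 'rV[R]_n)) :=
  A m `<=` \bigcup_k box (B k) /\
  \sum_(k <oo) (volume (B k))%:E
    <= lebesgue_outer (A m) + (e / (2 ^ m.+1)%:R)%:E.
have [G PG] : {G : nat -> nat -> option ('rV[R]_n * 'rV[R]_n) &
    forall m, P m (G m)}.
  apply: (@choice _ _ P) => m.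
  have em : (0 < e / (2 ^ m.+1)%:R :> R)%R by rewrite divr_gt0// ltr0n expn_gt0.
  have fin : lebesgue_outer (A m) \is a fin_num.
    rewrite ge0_fin_numE ?lebesgue_outer_ge0// ltey; exact/eqP/Aoo.
  have [_ [B AB <-] ltB] := lb_ereal_inf_adherent em fin.
  by exists B; split => //; exact: ltW.
pose v (z : nat * nat) : \bar R := (volume (G z.1 z.2))%:E.
have v0 z : 0 <= v z by exact: evolume_ge0.
apply: (@le_trans _ _ (\esum_(z in setT) v z)).
  have /card_esym/ppcard_eqP[f] := card_nat2.
  apply: ereal_inf_lbound; exists (fun k => G (f k).1 (f k).2).
    move=> x [i _] /(PG i).1 [j _ Gij]; exists (f^-1%FUN (i, j)) => //=.
    by rewrite invK ?inE.
  rewrite -[RHS](_ : \sum_(k <oo) v (f k) = _)//.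
  rewrite -(esum_pred_image v f xpredT) ?[fun=> _]set_true//.
  by rewrite image_eq.
rewrite (_ : esum _ _ = \sum_(i <oo) \sum_(j <oo) v (i, j)); last first.
  pose J i : set (nat * nat) := [set (i, j) | j in setT].
  rewrite (_ : setT = \bigcup_k J k); last first.
    by rewrite predeqE => -[i j]; split => // _; exists i => //; exists j.
  rewrite esum_bigcupT//=; last first.
    apply/trivIsetP => i j _ _ ij.
    rewrite predeqE => -[k l] /=; split => //= -[] [_] _ [<-{k} _].
    by move=> [? _] [] /esym/eqP; rewrite (negbTE ij).
  rewrite -(image_id [set: nat]) -fun_true esum_pred_image//; last first.
    by move=> k _; exact: esum_ge0.
  apply: eq_eseriesr => /= j _.
  rewrite -(esum_pred_image v (pair j) predT)//=; last first.
    by move=> ? ? _ _; exact: (@can_inj _ _ _ snd).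
  by congr esum; rewrite predeqE => -[k l]; split; move=> [i _ <-]; exists i.
apply: lee_nneseries => [i _ _|i _]; first by apply: nneseries_ge0.
exact: (PG i).2.
Qed.

HB.instance Definition _ := isOuterMeasure.Build R 'rV[R]_n lebesgue_outer
  lebesgue_outer0 lebesgue_outer_ge0 le_lebesgue_outer
  lebesgue_outer_sigma_subadditive.

End lebesgue_Rn.
Arguments lebesgue_outer : clear implicits.

(* The Caratheodory-measurable sets are the Lebesgue (not only the Borel)
   measurable sets. *)
Notation lebesgue_space R n := (caratheodory_type (lebesgue_outer R n)).

Definition lebesgue (R : realType) (n : nat) : set (lebesgue_space R n) -> \bar R :=
  lebesgue_outer R n.

Section lebesgue_measure_Rn.
Context {R : realType} {n : nat}.
Local Open Scope ereal_scope.

HB.instance Definition _ := isMeasure.Build _ _ _ (@lebesgue R n)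
  (@caratheodory_measure0 _ _ (lebesgue_outer R n))
  (@caratheodory_measure_ge0 _ _ (lebesgue_outer R n))
  (@caratheodory_measure_sigma_additive _ _ (lebesgue_outer R n)).

Let upd (a : 'rV[R]_n) i t : 'rV[R]_n := \row_j if j == i then t else a ord0 j.

Lemma measurable_halfspace (i : 'I_n) (t : R) :
  measurable ([set x : 'rV[R]_n | x ord0 i <= t]%R : set (lebesgue_space R n)).
Proof.
set H := [set x | _]; apply: le_caratheodory_measurable => X.
apply: le_ereal_inf_tmp => _ [B XB <-].
pose lo (C : option ('rV[R]_n * 'rV[R]_n)) :=
  omap (fun ab => (ab.1, upd ab.2 i (Num.min (ab.2 ord0 i) t))) C.
pose hi (C : option ('rV[R]_n * 'rV[R]_n)) :=
  omap (fun ab => (upd ab.1 i (Num.max (ab.1 ord0 i) t), ab.2)) C.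
have loE C : box C `&` H `<=` box (lo C).
  case: C => [[a b]|] //= x [] //= abx xt j; rewrite /upd mxE.
  case: eqP => [->|_]; last exact: abx.
  by have /andP[-> xb] := abx i; rewrite le_min xb.
have hiE C : box C `&` ~` H `<=` box (hi C).
  case: C => [[a b]|] //= x [] //= abx /negP; rewrite -ltNge => tx j.
  rewrite /upd mxE; case: eqP => [->|_]; last exact: abx.
  by have /andP[ax ->] := abx i; rewrite gt_max ax tx.
have vE C : volume C = (volume (lo C) + volume (hi C))%R.
  case: C => [[a b]|] /=; last by rewrite addr0.
  rewrite (bigD1 i)//= [X in (_ = X + _)%R](bigD1 i)//=.
  rewrite [X in (_ = _ + X)%R](bigD1 i)//= /upd !mxE eqxx.
  set P := (\prod_(_ < n | _) _)%R.
  rewrite [X in (_ = _ * X + _)%R](_ : _ = P); last first.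
    by apply: eq_bigr => j ji; rewrite mxE (negbTE ji).
  rewrite [X in (_ = _ + _ * X)%R](_ : _ = P); last first.
    by apply: eq_bigr => j ji; rewrite mxE (negbTE ji).
  rewrite -mulrDl; congr (_ * _)%R.
  move: (a ord0 i) (b ord0 i) => p q.
  have [?|?] := leP q t; have [?|?] := leP p t;
  rewrite /Num.max; repeat case: ifPn; rewrite -?leNgt => *; lra.
rewrite (_ : \sum_(k <oo) (volume (B k))%:E =
    \sum_(k <oo) (volume (lo (B k)))%:E + \sum_(k <oo) (volume (hi (B k)))%:E); last first.
  rewrite -nneseriesD; try by move=> k _ _; rewrite lee_fin volume_ge0.
  by apply: eq_eseriesr => k _; rewrite -EFinD -vE.
apply: leeD; apply: ereal_inf_lbound.
- exists (lo \o B) => // x [Xx Hx]; have [k _ Bx] := XB _ Xx.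
  by exists k => //; exact: loE.
- exists (hi \o B) => // x [Xx Hx]; have [k _ Bx] := XB _ Xx.
  by exists k => //; exact: hiE.
Qed.

Lemma measurable_box (B : option ('rV[R]_n * 'rV[R]_n)) :
  measurable (box B : set (lebesgue_space R n)).
Proof.
case: B => [[a b]|]; last exact: measurable0.
rewrite (_ : box _ = \bigcap_(i in [set: 'I_n])
    (~` [set x | x ord0 i <= a ord0 i] `&` [set x | x ord0 i <= b ord0 i])%R).
  apply: fin_bigcap_measurable => // i _; apply: measurableI;
    [apply: measurableC|]; exact: measurable_halfspace.
apply/seteqP; split => x /= abx i => [_|].
  by have /andP[ax xb] := abx i; split => //=; apply/negP; rewrite -ltNge.
by have [//|/negP] := abx i; rewrite -ltNge => -> ->.
Qed.

Let lebesgue_sigma_finite : sigma_finite setT (@lebesgue R n).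
Proof.
pose Q k : option ('rV[R]_n * 'rV[R]_n) :=
  Some (const_mx (- k%:R), const_mx k%:R)%R.
exists (fun k => box (Q k)); last first.
  move=> k; split; first exact: measurable_box.
  apply: (@le_lt_trans _ _ (volume (Q k))%:E); last exact: ltry.
  apply: ereal_inf_lbound; exists (fun j => if (j == 0)%N then Q k else None).
    by move=> x Qx; exists 0%N.
  rewrite nneseries_recl//; last by move=> j _; rewrite lee_fin volume_ge0.
  by rewrite eseries0 ?adde0// => -[].
apply/esym; rewrite -subTset => x _.
pose M : R := (\sum_(i < n) `|x ord0 i|)%R.
have M0 : (0 <= M)%R by exact: sumr_ge0.
exists (Num.truncn M).+1 => // i; rewrite !mxE.
have xM : (`|x ord0 i| < (Num.truncn M).+1%:R)%R.
  apply: (le_lt_trans _ (truncnS_gt M)).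
  by rewrite /M (bigD1 i)//= lerDl sumr_ge0.
by move: xM; rewrite ltr_norml => /andP[-> /ltW].
Qed.

HB.instance Definition _ := Measure_isSigmaFinite.Build _ _ _ (@lebesgue R n)
  lebesgue_sigma_finite.

End lebesgue_measure_Rn.
Arguments lebesgue : clear implicits.

Definition compact_domain (R : realType) (n : nat) (Om : set 'rV[R]_n) : Prop :=
  compact Om /\ (0 < lebesgue R n Om)%E.

(* Functions on a domain are represented by total functions whose values outside
   of the domain are irrelevant, and elements of L^2 by representatives. *)
Definition L2 (d : measure_display) (T : measurableType d) (R : realType)
    (mu : {measure set T -> \bar R}) (D : set T) (f : T -> R) : Prop :=
  f \_ D \in Lfun mu 2%:E.

Definition L2norm (d : measure_display) (T : measurableType d) (R : realType)
    (mu : {measure set T -> \bar R}) (D : set T) (f : T -> R) : R :=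
  fine ('N[mu]_2%:E[EFin \o f \_ D])%E.

Section problem.
Context (R : realType) (d1 d2 : nat).
Variables (Om1 : set 'rV[R]_d1) (Om2 : set 'rV[R]_d2).

(* On the product, Lebesgue measure is the product measure; as it is not
   completed, every L^2 class still has a measurable representative. *)
Local Notation l1 := (lebesgue R d1).
Local Notation l2 := (lebesgue R d2).
Local Notation l := (l1 \x l2)%E.

Definition objective (c : 'rV[R]_d1 * 'rV[R]_d2 -> R) (gamma : R)
    (p : 'rV[R]_d1 * 'rV[R]_d2 -> R) : R :=
  \int[l]_(z in Om1 `*` Om2) (c z * p z)
    + gamma / 2 * L2norm l (Om1 `*` Om2) p ^+ 2.

(* The marginals are extended-real integrals, so that the constraints include
   their finiteness. *)
Definition feasible (mu1 : 'rV[R]_d1 -> R) (mu2 : 'rV[R]_d2 -> R)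
    (p : 'rV[R]_d1 * 'rV[R]_d2 -> R) : Prop :=
  [/\ L2 l (Om1 `*` Om2) p,
      {ae l1, forall x1, Om1 x1 ->
        (\int[l2]_(x2 in Om2) (p (x1, x2))%:E = (mu1 x1)%:E)%E},
      {ae l2, forall x2, Om2 x2 ->
        (\int[l1]_(x1 in Om1) (p (x1, x2))%:E = (mu2 x2)%:E)%E} &
      {ae l, forall z, (Om1 `*` Om2) z -> 0 <= p z}].

Definition optimal (c : 'rV[R]_d1 * 'rV[R]_d2 -> R) (gamma : R)
    (mu1 : 'rV[R]_d1 -> R) (mu2 : 'rV[R]_d2 -> R)
    (p : 'rV[R]_d1 * 'rV[R]_d2 -> R) : Prop :=
  feasible mu1 mu2 p /\
  forall q, feasible mu1 mu2 q -> objective c gamma p <= objective c gamma q.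

End problem.

(* Main.v *)
Require Import Defs.
From HB Require Import structures.
From mathcomp Require Import all_boot all_order all_algebra.
From mathcomp Require Import all_classical all_reals all_analysis.
From mathcomp Require Import measurable_realfun lra ring.

(* Completing the square turns the objective, up to constants, into the squared
   L^2 distance to [- c / gamma], so an optimal solution is the projection of
   that point onto the convex set of feasible plans. A minimizing sequence chosen
   with geometric rate is Cauchy by the parallelogram identity; as the domain has
   finite measure, its increments are summable in L^1, hence it converges almost
   everywhere and is dominated by an integrable function. Fatou's lemma makes the
   limit a minimizer, and dominated convergence on almost every section carries
   the marginal constraints over to the limit. So an optimal solution exists as
   soon as a feasible plan does. Under the stated conditions the normalised
   product [mu1 * mu2 / mass] is feasible; conversely the conditions on the
   marginals of a feasible plan follow from Cauchy-Schwarz and Fubini. *)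

Set Implicit Arguments.
Unset Strict Implicit.
Unset Printing Implicit Defensive.

Import Order.TTheory GRing.Theory Num.Theory.
Import numFieldNormedType.Exports.

Local Open Scope classical_set_scope.
Local Open Scope ring_scope.

(** * Lebesgue measurability and finite measure of compact sets *)

Section compact_lebesgue.
Context (R : realType) (n : nat).
Implicit Types (x y : 'rV[R]_n) (e : R) (K : set 'rV[R]_n).

(** Half-open, hence measurable by [measurable_box], yet still a neighbourhood of its centre. *)
Let cube x e := box (Some (x - const_mx e, x + const_mx e)).

Let cubeP x e y : cube x e y <-> forall i, x 0 i - e < y 0 i <= x 0 i + e.
Proof. by split => H i; have := H i; rewrite !mxE. Qed.

Let nbhs_cube x e : 0 < e -> nbhs x (cube x e).
Proof.
move=> e0; apply/nbhs_ballP; exists e => //= y [_ xy]; apply/cubeP => i.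
by have := xy 0 i; rewrite /ball/= ltr_norml => /andP[? ?]; apply/andP; split; lra.
Qed.

Lemma lebesgue_box_lty B : (lebesgue R n (box B) < +oo)%E.
Proof.
apply: (@le_lt_trans _ _ (volume B)%:E); last exact: ltry.
apply: ereal_inf_lbound; exists (fun j => if (j == 0)%N then B else None).
  by move=> x Qx; exists 0%N.
rewrite nneseries_recl//; last by move=> j _; rewrite lee_fin volume_ge0.
by rewrite eseries0 ?adde0// => -[].
Qed.

(** A finite subcover of the open interiors of the cubes. The centres are kept in [K], so that every
    covered point is close to a point of [K]. *)
Lemma compact_cubes K e : compact K -> 0 < e ->
  exists s : seq 'rV[R]_n, (forall x, x \in s -> K x) /\
    K `<=` \bigcup_(x in [set` s]) cube x e.
Proof.
move=> + e0; rewrite compact_cover => /(_ _ K (fun x => (cube x e)^°)) [].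
- by move=> i _; exact: open_interior.
- by move=> x Kx; exists x => //; exact: nbhs_cube.
move=> D DK KD; exists (finmap.enum_fset D); split.
  by move=> x xD; have := DK x xD; rewrite inE.
by move=> x /KD[y yD xy]; exists y => //; exact: interior_subset xy.
Qed.

Let measurable_cubes (s : seq 'rV[R]_n) e :
  measurable (\bigcup_(x in [set` s]) cube x e : set (lebesgue_space R n)).
Proof.
by apply: fin_bigcup_measurable => // x _; exact: measurable_box.
Qed.

(** [K] is the intersection over [k] of its finite covers by cubes of half-side [k.+1%:R^-1]: a
    point of every cover is arbitrarily close to [K], hence lies in it, as [K] is closed. *)
Lemma compact_lebesgue_measurable K : compact K ->
  measurable (K : set (lebesgue_space R n)).
Proof.
move=> cK.
(* The [eq_ind_r] term proves that the half-side [k.+1%:R^-1] is positive. *)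
have [s sK] := choice (fun k =>
  compact_cubes cK (eq_ind_r is_true (ltr0Sn R k) (invr_gt0 (k.+1%:R : R)))).
suff -> : K = \bigcap_k \bigcup_(x in [set` s k]) cube x k.+1%:R^-1.
  by apply: bigcap_measurable => // k _; exact: measurable_cubes.
apply/seteqP; split => [x Kx k _|x sx]; first exact: (sK k).2.
have /closure_id -> : closed K by apply: compact_closed => //; exact: norm_hausdorff.
move=> B /nbhs_ballP[e /= e0 eB].
have [k ke] : exists k, (k.+1%:R^-1 < e :> R).
  exists (Num.truncn e^-1); rewrite invf_plt ?posrE//.
  exact: truncnS_gt.
have [y ys /cubeP yx] := sx k I; exists y; split; first exact: (sK k).1.
apply: eB; split => // i j; rewrite ord1.
move: (k.+1%:R^-1) ke (yx j) => {sx yx} d ke /andP[? ?].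
by rewrite /ball/= ltr_norml; apply/andP; split; lra.
Qed.

Lemma compact_lebesgue_lty K : compact K -> (lebesgue R n K < +oo)%E.
Proof.
move=> cK; have [s [_ Ks]] := compact_cubes cK ltr01.
apply: (le_lt_trans (le_lebesgue_outer Ks)).
rewrite bigcup_seq; elim: s {Ks} => [|x s IHs].
  by rewrite big_nil lebesgue_outer0.
rewrite big_cons.
apply: (le_lt_trans (outer_measureU2 _ _ _)).
by rewrite lte_add_pinfty//; exact: lebesgue_box_lty.
Qed.

End compact_lebesgue.

(** * Square-integrable functions: algebra, an L^1 bound, Fatou's lemma *)

Section square_integrable.
Context (d : measure_display) (T : measurableType d) (R : realType).
Variable m : {measure set T -> \bar R}.
Implicit Types (f g h : T -> R) (D : set T).
Local Notation sqint := (Lfun m 2%:E).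

Lemma sqint_measurable f : f \in sqint -> measurable_fun setT f.
Proof. by move=> /sub_Lfun_mfun; rewrite inE. Qed.

Lemma sqintP f : f \in sqint <->
  measurable_fun setT f /\ (\int[m]_x (f x ^+ 2)%:E < +oo)%E.
Proof.
split=> [Lf|[mf intf]].
  split; first exact: sqint_measurable.
  exact: (integrable_lty measurableT (Lfun2_integrable_sqr Lf)).
rewrite inE; apply/andP; split; rewrite inE//=.
rewrite /finite_norm unlock/= poweR_lty//.
rewrite (_ : (\int[m]_x _)%E = \int[m]_x (f x ^+ 2)%:E)%E//.
by apply: eq_integral => x _ /=; rewrite powR_mulrn// -normrX ger0_norm ?sqr_ge0.
Qed.

Lemma sqr_Lnorm2 f : f \in sqint ->
  fine ('N[m]_2%:E[EFin \o f])%E ^+ 2 = \int[m]_x (f x ^+ 2).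
Proof.
move=> Lf; have /sub_Lfun_finLfun := Lf; rewrite inE/= => finf.
rewrite -powR_mulrn ?fine_ge0 ?Lnorm_ge0//.
have -> : fine ('N[m]_2%:E[EFin \o f])%E `^ 2 = fine ('N[m]_2%:E[EFin \o f] `^ 2)%E.
  move: finf (Lnorm_ge0 m 2%:E (EFin \o f)); rewrite /finite_norm.
  by case: (Lnorm _ _ _) => [r| |]//; rewrite poweR_EFin.
rewrite powR_Lnorm//; congr fine; apply: eq_integral => x _ /=.
by rewrite powR_mulrn// -normrX ger0_norm ?sqr_ge0.
Qed.

Lemma sqintD f g : f \in sqint -> g \in sqint -> f \+ g \in sqint.
Proof.
move=> Lf Lg; have := @Lfun_addr_closed _ _ _ m 2%:E (lee1n 2).
by move=> [_]; apply.
Qed.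

Lemma sqintZ k f : f \in sqint -> (fun x => k * f x) \in sqint.
Proof.
have -> : (fun x => k * f x) = k \o* f by apply/funext => x/=; rewrite mulrC.
by apply: Lfun_scale; rewrite ler1n.
Qed.

Lemma sqintB f g : f \in sqint -> g \in sqint -> (fun x => f x - g x) \in sqint.
Proof.
move=> Lf Lg.
have -> : (fun x => f x - g x) = f \+ (fun x => -1 * g x).
  by apply/funext => x/=; rewrite mulN1r.
exact/sqintD/sqintZ.
Qed.

Lemma sqintM f g : f \in sqint -> g \in sqint ->
  m.-integrable setT (fun x => (f x * g x)%:E).
Proof. by move=> Lf Lg; exact/Lfun1_integrable/Lfun2_mul_Lfun1. Qed.

Lemma integrableZ_EFin k f : m.-integrable setT (EFin \o f) ->
  m.-integrable setT (EFin \o (fun x => k * f x)).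
Proof. by move=> int_f; exact: (integrableZl measurableT k int_f). Qed.

Lemma EFin_Rintegral f : m.-integrable setT (EFin \o f) ->
  (\int[m]_x f x)%:E = (\int[m]_x (f x)%:E)%E.
Proof. by move=> ?; rewrite fineK//; exact: integrable_fin_num. Qed.

(** If [|a|] is at most [t], the second term suffices; otherwise [|a| * t] is at most [a ^+ 2]. *)
Lemma sqr_young (a t : R) : 0 < t -> `|a| <= a ^+ 2 / t + t.
Proof.
move=> t0; have [at'|ta] := leP `|a| t.
  by rewrite (le_trans at')// lerDr divr_ge0 ?sqr_ge0// ltW.
rewrite -[leLHS]addr0 lerD//; last exact: ltW.
by rewrite ler_pdivlMr// -real_normK ?num_real// expr2 ler_wpM2l// ltW.
Qed.

(** Integrating [sqr_young] over [D]. This serves as a Cauchy-Schwarz inequality in which each use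
    picks its own [t]. *)
Lemma sqint_le_integral_norm f D (t : R) : measurable D -> (m D < +oo)%E ->
  f \in sqint -> (forall x, ~ D x -> f x = 0) -> 0 < t ->
  (\int[m]_x `|f x|%:E <=
    (\int[m]_x (f x ^+ 2) / t + t * fine (m D))%:E)%E.
Proof.
move=> mD fD Lf f0 t0; have mf := sqint_measurable Lf.
have if2 := Lfun2_integrable_sqr Lf.
have mDE : m D = (fine (m D))%:E by rewrite fineK// ge0_fin_numE.
apply: (@le_trans _ _ (\int[m]_x ((t^-1)%:E * (f x ^+ 2)%:E + t%:E * (\1_D x)%:E))%E).
  apply: ge0_le_integral => //.
  - by apply/measurable_EFinP; exact: measurableT_comp.
  - apply: emeasurable_funD; apply: emeasurable_funM => //.
      by apply/measurable_EFinP; exact: measurable_funX.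
    by apply/measurable_EFinP; exact: measurable_indic.
  - move=> x _; rewrite -!EFinM -EFinD lee_fin indicE.
    have [xD|xD] := boolP (x \in D).
      by rewrite mulr1 mulrC sqr_young.
    by rewrite f0 ?normr0 ?expr0n/= ?mulr0 ?addr0//; move=> /mem_set; exact/negP.
rewrite ge0_integralD//.
- rewrite !ge0_integralZl//.
  + rewrite integral_indic// setIT {1}mDE -EFin_Rintegral// -!EFinM -EFinD.
    by rewrite mulrC.
  + by apply/measurable_EFinP; exact: measurable_indic.
  + by rewrite lee_fin ltW.
  + by apply/measurable_EFinP; exact: measurable_funX.
  + by move=> x _; rewrite lee_fin sqr_ge0.
  + by rewrite lee_fin invr_ge0 ltW.
- by move=> x _; rewrite mule_ge0// lee_fin ?invr_ge0 ?sqr_ge0// ltW.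
- apply: emeasurable_funM => //.
  by apply/measurable_EFinP; exact: measurable_funX.
- by move=> x _; rewrite mule_ge0// lee_fin// ltW.
- apply: emeasurable_funM => //.
  by apply/measurable_EFinP; exact: measurable_indic.
Qed.

Lemma sqint_integrable f D : measurable D -> (m D < +oo)%E ->
  f \in sqint -> (forall x, ~ D x -> f x = 0) -> m.-integrable setT (EFin \o f).
Proof.
move=> mD fD Lf f0; apply/integrableP; split.
  by apply/measurable_EFinP; exact: sqint_measurable.
by apply: (le_lt_trans (sqint_le_integral_norm mD fD Lf f0 ltr01)); rewrite ltry.
Qed.

(** Fatou for the squares: the lower limit of their integrals is at most the limit of the bounds
    [b]. *)
Lemma sqint_fatou (h_ : nat -> T -> R) h (b : nat -> R) (l : R) :
  (forall n, measurable_fun setT (h_ n)) ->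
  (forall x, h_ ^~ x @ \oo --> h x) ->
  (forall n, (\int[m]_x (h_ n x ^+ 2)%:E <= (b n)%:E)%E) -> b @ \oo --> l ->
  (\int[m]_x (h x ^+ 2)%:E <= l%:E)%E.
Proof.
move=> mh hh hb bl.
have mh2 n : measurable_fun setT (fun x => (h_ n x ^+ 2)%:E).
  by apply/measurable_EFinP; exact: measurable_funX.
have h20 n x : setT x -> (0 <= (h_ n x ^+ 2)%:E)%E by rewrite lee_fin sqr_ge0.
have := fatou m measurableT mh2 h20.
have -> : (\int[m]_x limn_einf (fun n => (h_ n x ^+ 2)%:E) =
    \int[m]_x (h x ^+ 2)%:E)%E.
  apply: eq_integral => x _; rewrite (cvg_limn_einf_sup (l := (h x ^+ 2)%:E))//.
  apply: cvg_EFin; first exact: nearW.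
  by under eq_fun do rewrite expr2; rewrite expr2; apply: cvgM; exact: hh.
move=> /le_trans; apply; rewrite limn_einf_lim.
have bl' : (EFin \o b) @ \oo --> l%:E by apply: cvg_EFin => //; exact: nearW.
rewrite -(cvg_lim _ bl')//; apply: lee_lim; first exact: is_cvg_einfs.
  by apply/cvg_ex; exists l%:E.
apply: nearW => n; apply: le_trans (hb n); apply: ereal_inf_lbound.
by exists n => /=.
Qed.

End square_integrable.

(** * Projection onto a convex set of square-integrable functions *)

Section projection.
Context (d : measure_display) (T : measurableType d) (R : realType).
Variables (m : {measure set T -> \bar R}) (D : set T).
Hypotheses (mD : measurable D) (finD : (m D < +oo)%E).
Implicit Types (f g h p q : T -> R).
Local Notation sqint := (Lfun m 2%:E).

(* By [sqr_young], taken with [t] the L^2 size of the increment, the L^2 rate is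
   also an L^1 rate, so the sum of the increments is integrable. *)
Lemma sqint_fast_cauchy (q_ : nat -> T -> R) (C : R) : 0 <= C ->
  (forall n, q_ n \in sqint) -> (forall n x, ~ D x -> q_ n x = 0) ->
  (forall n, \int[m]_x ((q_ n.+1 x - q_ n x) ^+ 2) <=
    C * ((2 ^ n.+1)%:R^-1) ^+ 2) ->
  exists g : T -> \bar R, [/\ m.-integrable setT g,
    forall x n, (`|q_ n x|%:E <= g x)%E &
    forall x, (g x < +oo)%E -> cvgn (q_ ^~ x)].
Proof.
move=> C0 Lq q0 qC.
pose a n x := q_ n.+1 x - q_ n x.
have La n : a n \in sqint by exact: sqintB.
have ma n : measurable_fun setT (fun x => `|a n x|%:E).
  by apply/measurable_EFinP/measurableT_comp => //; exact: (sqint_measurable (La n)).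
have mq n : measurable_fun setT (fun x => `|q_ n x|%:E).
  by apply/measurable_EFinP/measurableT_comp => //; exact: (sqint_measurable (Lq n)).
have a0 n x : ~ D x -> a n x = 0 by move=> Dx; rewrite /a !q0// subrr.
have ia n : (\int[m]_x `|a n x|%:E <=
    ((C + fine (m D)) / (2 ^ n.+1)%:R)%:E)%E.
  (* With [t] equal to the geometric rate, [C * t ^+ 2 / t + t * fine (m D)] is
     [(C + fine (m D)) * t]. *)
  have t0 : 0 < (2 ^ n.+1)%:R^-1 :> R by rewrite invr_gt0 ltr0n expn_gt0.
  apply: (le_trans (sqint_le_integral_norm mD finD (La n) (a0 n) t0)).
  rewrite lee_fin mulrDl [X in _ <= _ + X]mulrC lerD2r.
  by rewrite ler_pdivrMr// (le_trans (qC n))// expr2 mulrA.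
pose s x := (\sum_(n <oo) `|a n x|%:E)%E.
have s0 x : (0 <= s x)%E by exact: nneseries_ge0.
have ms : measurable_fun setT s.
  by apply: (@ge0_emeasurable_sum _ _ _ setT (fun n x => `|a n x|%:E) xpredT).
have part x n : ((\sum_(0 <= k < n) `|a k x|)%:E <= s x)%E.
  by rewrite -sumEFin; exact: nneseries_lim_ge.
(* By telescoping, [q_ n] is the first term plus a partial sum of increments, so [g] dominates the
   whole sequence. *)
pose g x := (`|q_ 0%N x|%:E + s x)%E.
have tele n x : q_ n x = q_ 0%N x + \sum_(0 <= k < n) a k x.
  by rewrite telescope_sumr// addrC subrK.
exists g; split.
- apply/integrableP; split; first exact: emeasurable_funD.
  under eq_integral do rewrite gee0_abs ?adde_ge0//.
  rewrite ge0_integralD//= integral_nneseries//=.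
  apply: lte_add_pinfty.
    by have /integrableP[] := sqint_integrable mD finD (Lq 0%N) (q0 0%N).
  apply: (@le_lt_trans _ _ (C + fine (m D))%:E); last exact: ltry.
  apply: (le_trans (lee_nneseries _ (fun n _ => ia n))).
    by move=> n _ _; apply: integral_ge0 => x _; rewrite lee_fin.
  by apply: epsilon_trick0; rewrite addr_ge0// fine_ge0.
- move=> x n; rewrite tele; apply: (@le_trans _ _
    (`|q_ 0%N x| + \sum_(0 <= k < n) `|a k x|)%:E).
    by rewrite lee_fin (le_trans (ler_normD _ _))// lerD2l ler_norm_sum.
  by rewrite EFinD leeD2l.
- move=> x gx.
  have sx : (s x < +oo)%E.
    by apply: le_lt_trans gx; rewrite leeDr.
  under eq_fun do rewrite tele.
  apply: is_cvgD; first exact: is_cvg_cst.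
  (* Absolute convergence: the partial sums of the norms increase and stay below [s x]. *)
  apply: (@normed_cvg _ R^o (fun k => a k x)).
  apply: nondecreasing_is_cvgn.
    by apply: nondecreasing_series => k _ _; exact: normr_ge0.
  exists (fine (s x)) => _ [n _ <-].
  by rewrite -lee_fin fineK ?ge0_fin_numE//; exact: part.
Qed.

(** The usual identity for the vectors [p - f] and [q - f], valid pointwise: their difference is
    [p - q] and their half sum is the midpoint minus [f]. *)
Lemma parallelogram f p q : f \in sqint -> p \in sqint -> q \in sqint ->
  \int[m]_x ((p x - q x) ^+ 2) =
  2 * \int[m]_x ((p x - f x) ^+ 2) + 2 * \int[m]_x ((q x - f x) ^+ 2)
  - 4 * \int[m]_x ((2^-1 * (p x + q x) - f x) ^+ 2).
Proof.
move=> Lf Lp Lq.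
have i1 := Lfun2_integrable_sqr (sqintB Lp Lf).
have i2 := Lfun2_integrable_sqr (sqintB Lq Lf).
have i3 := Lfun2_integrable_sqr (sqintB (sqintZ 2^-1 (sqintD Lp Lq)) Lf).
have iD h1 h2 : m.-integrable setT (EFin \o h1) ->
    m.-integrable setT (EFin \o h2) ->
    m.-integrable setT (EFin \o (fun x => h1 x + h2 x)).
  by move=> ih1 ih2; exact: (integrableD measurableT ih1 ih2).
rewrite -!RintegralZl// -RintegralD//; [|exact: integrableZ_EFin..].
rewrite -RintegralB//; [|by apply: iD; exact: integrableZ_EFin|exact: integrableZ_EFin].
by apply: eq_Rintegral => x _ /=; field.
Qed.

(** The limit [q] is compared with all of [K] before it is known to lie in [K]. The sequence and its
    dominating function are returned so that the caller can prove membership. *)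
Lemma sqint_projection (K : set (T -> R)) f :
  f \in sqint -> (forall x, ~ D x -> f x = 0) ->
  K !=set0 -> (forall p, K p -> p \in sqint) ->
  (forall p x, K p -> ~ D x -> p x = 0) ->
  (forall p q, K p -> K q -> K (fun x => 2^-1 * (p x + q x))) ->
  exists (q_ : nat -> T -> R) (g : T -> \bar R) (q : T -> R),
    [/\ forall n, K (q_ n), m.-integrable setT g,
        forall x n, (`|q_ n x|%:E <= g x)%E,
        forall x, (g x < +oo)%E -> q_ ^~ x @ \oo --> q x &
        [/\ q \in sqint, forall x, ~ D x -> q x = 0 &
          forall p, K p -> \int[m]_x ((q x - f x) ^+ 2) <=
            \int[m]_x ((p x - f x) ^+ 2)]].
Proof.
move=> Lf f0 [p0 Kp0] LK K0 Kmid.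
pose E p := \int[m]_x ((p x - f x) ^+ 2).
have E0 p : 0 <= E p by apply: Rintegral_ge0 => x _; exact: sqr_ge0.
have infE : has_inf [set E p | p in K].
  by split; [exists (E p0), p0|exists 0 => _ [p _ <-]].
set l := inf [set E p | p in K].
have lE p : K p -> l <= E p by move=> Kp; apply: ge_inf; [exact: infE.2|exists p].
(* The square of [t n] bounds the excess of [E (q_ n)] over the infimum, which gives the increments
   the rate required by [sqint_fast_cauchy]. *)
pose t n : R := (2 ^ n.+1)%:R^-1.
have t0 n : 0 < t n by rewrite invr_gt0 ltr0n expn_gt0.
have [q_ Kq] : {q_ : nat -> T -> R &
    forall n, K (q_ n) /\ E (q_ n) < l + t n ^+ 2}.
  apply: (@choice _ _ (fun n p => K p /\ E p < l + t n ^+ 2)) => n.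
  have [_ [p Kp <-] Ep] := inf_adherent (exprn_gt0 2 (t0 n)) infE.
  by exists p.
have tS n : t n.+1 <= t n.
  by rewrite lef_pV2 ?posrE ?ltr0n ?expn_gt0// ler_nat leq_exp2l.
(* The midpoint lies in [K], so its [E] is at least [l]; the terms in [l] cancel in the
   parallelogram identity and [(2 + 2) * t n ^+ 2] remains. *)
have q_diff n : \int[m]_x ((q_ n.+1 x - q_ n x) ^+ 2) <= 4 * t n ^+ 2.
  have [Kn En] := Kq n; have [Kn1 En1] := Kq n.+1.
  rewrite (parallelogram Lf (LK _ Kn1) (LK _ Kn)).
  have := lE _ (Kmid _ _ Kn1 Kn); rewrite -/(E _) -/(E (q_ n)) /E => lm.
  have : t n.+1 ^+ 2 <= t n ^+ 2 by rewrite ler_pXn2r// nnegrE ltW.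
  move: En En1; rewrite /E; lra.
have [g [ig qg gcvg]] := sqint_fast_cauchy (ler0n R 4)
  (fun n => LK _ (Kq n).1) (fun n x => K0 _ x (Kq n).1) q_diff.
pose G := [set x | (g x < +oo)%E].
have mG : measurable G.
  rewrite -[G]setTI; apply: emeasurable_fun_infty_o => //.
  exact: measurable_int ig.
(* On the null set where the sequence may diverge, the value [f] makes
   [q - f] an everywhere limit. *)
pose q x := if x \in G then limn (q_ ^~ x) else f x.
have qcvg x : G x -> q_ ^~ x @ \oo --> q x.
  by move=> Gx; rewrite /q mem_set//; exact: gcvg.
pose h_ n x := (q_ n x - f x) * \1_G x.
have mh n : measurable_fun setT (h_ n).
  apply: measurable_funM; last exact: measurable_indic.
  by apply: sqint_measurable; exact: sqintB (LK _ (Kq n).1) Lf.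
have hcvg x : h_ ^~ x @ \oo --> q x - f x.
  rewrite /h_ indicE; have [xG|xG] := boolP (x \in G).
    under eq_fun do rewrite mulr1.
    by apply: cvgB; [apply: qcvg; rewrite inE in xG|exact: cvg_cst].
  under eq_fun do rewrite mulr0.
  by rewrite /q (negbTE xG) subrr; exact: cvg_cst.
have qfl : (\int[m]_x ((q x - f x) ^+ 2)%:E <= l%:E)%E.
  apply: (sqint_fatou mh hcvg (b := fun n => l + t n ^+ 2)).
    move=> n; have Lqf := sqintB (LK _ (Kq n).1) Lf.
    have iqf := Lfun2_integrable_sqr Lqf.
    apply: (@le_trans _ _ (E (q_ n))%:E); last first.
      by rewrite lee_fin ltW// (Kq n).2.
    rewrite /E EFin_Rintegral//; apply: ge0_le_integral => //.
    - by move=> x _; rewrite lee_fin sqr_ge0.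
    - by apply/measurable_EFinP; exact: measurable_funX.
    - exact: measurable_int iqf.
    - move=> x _; rewrite lee_fin /h_ indicE; case: (x \in G).
        by rewrite mulr1.
      by rewrite mulr0 expr0n/= sqr_ge0.
  rewrite -[X in _ --> X]addr0; apply: cvgD; first exact: cvg_cst.
  have tt0 : t @ \oo --> (0 : R).
    rewrite (_ : t = fun n => 2^-1 ^+ n.+1); last first.
      by apply/funext => n; rewrite /t natrX exprVn.
    rewrite (cvg_shiftS (fun n => 2^-1 ^+ n : R)); apply: cvg_expr.
    by rewrite ger0_norm ?invr_ge0// invf_lt1 ?ltr1n.
  have := cvgM tt0 tt0; rewrite mulr0; apply.
(* Measurability passes to [q - f] as the everywhere limit of the measurable [h_ n]. *)
have Lqf : (fun x => q x - f x) \in sqint.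
  apply/sqintP; split; last by rewrite (le_lt_trans qfl)// ltry.
  by apply: measurable_fun_cvg => [n|x _]; [exact: mh|exact: hcvg].
exists q_, g, q; split => //; first by move=> n; exact: (Kq n).1.
split.
- have -> : q = (fun x => q x - f x) \+ f by apply/funext => x /=; rewrite subrK.
  exact: sqintD.
- move=> x Dx; rewrite /q; case: ifPn => _; last exact: f0.
  have -> : q_ ^~ x = cst 0 by apply/funext => n; rewrite (K0 _ _ (Kq n).1).
  by rewrite lim_cst.
- move=> p Kp; apply: le_trans (lE _ Kp); rewrite -lee_fin EFin_Rintegral//.
  exact: Lfun2_integrable_sqr Lqf.
Qed.

End projection.

(** * Integrals over a single section of a plan *)

Section one_space.
Context (d : measure_display) (T : measurableType d) (R : realType).
Variables (m : {measure set T -> \bar R}) (D : set T).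
Hypotheses (mD : measurable D).
Implicit Types (f g h p q : T -> R) (v : R).
Local Notation sqint := (Lfun m 2%:E).

Lemma integral_support (h : T -> \bar R) : (forall x, ~ D x -> h x = 0%E) ->
  (\int[m]_(x in D) h x = \int[m]_x h x)%E.
Proof.
move=> h0; rewrite integral_mkcond; apply: eq_integral => x _.
by rewrite patchE; case: ifPn => // /negP xD; rewrite h0// => /mem_set.
Qed.

Lemma integral_midpoint p q v :
  m.-integrable setT (EFin \o p) -> m.-integrable setT (EFin \o q) ->
  (\int[m]_(x in D) (p x)%:E = v%:E)%E -> (\int[m]_(x in D) (q x)%:E = v%:E)%E ->
  (\int[m]_(x in D) (2^-1 * (p x + q x))%:E = v%:E)%E.
Proof.
move=> ip iq pv qv.
have ipD := integrableS measurableT mD (@subsetT _ D) ip.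
have iqD := integrableS measurableT mD (@subsetT _ D) iq.
under eq_integral do rewrite EFinM EFinD.
rewrite (@integralZl _ _ _ m D mD (fun x => (p x)%:E + (q x)%:E)%E); last first.
  exact: integrableD.
by rewrite integralD// pv qv -EFinD -EFinM; congr EFin; field.
Qed.

Lemma integral_dominated_lim (q_ : nat -> T -> R) q (g : T -> \bar R) v :
  (forall n, measurable_fun setT (q_ n)) -> measurable_fun setT q ->
  m.-integrable setT g -> (forall x n, (`|q_ n x|%:E <= g x)%E) ->
  (forall x, (g x < +oo)%E -> q_ ^~ x @ \oo --> q x) ->
  (forall n, (\int[m]_(x in D) (q_ n x)%:E = v%:E)%E) ->
  (\int[m]_(x in D) (q x)%:E = v%:E)%E.
Proof.
move=> mq_ mq ig qg qcvg qv.
have igD := integrableS measurableT mD (@subsetT _ D) ig.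
have [||||_ _] := @dominated_convergence _ _ _ m D mD
  (fun n x => (q_ n x)%:E) (fun x => (q x)%:E) g _ _ _ igD.
- by move=> n; apply/measurable_EFinP; exact: measurable_funS (mq_ n).
- by apply/measurable_EFinP; exact: measurable_funS mq.
- apply: filterS (integrable_ae mD igD) => x gx Dx.
  apply: cvg_EFin; first exact: nearW.
  by apply: qcvg; have := gx Dx; rewrite fin_numElt => /andP[].
- by apply/aeW => x n _; rewrite abse_EFin.
under eq_fun do rewrite qv.
by move=> /cvg_lim <-//; rewrite lim_cst.
Qed.

(** Cauchy-Schwarz up to a constant, by a suitable [t] in [sqint_le_integral_norm]. It is stated
    with extended-real integrals, so that it applies to sections whose square integral may be
    infinite. *)
Lemma sqr_integral_le p v : (m D < +oo)%E ->
  measurable_fun setT p -> (forall x, ~ D x -> p x = 0) ->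
  (\int[m]_(x in D) (p x)%:E = v%:E)%E ->
  ((v ^+ 2)%:E <= (4 * (fine (m D) + 1))%:E * \int[m]_x (p x ^+ 2)%:E)%E.
Proof.
move=> finD mp p0 pv.
set M := fine (m D); have M0 : 0 <= M by exact: fine_ge0.
(* For [v = 0] the [t] chosen below would not be positive. *)
have [->|v0] := eqVneq v 0.
  rewrite expr0n/= mule_ge0//; first by rewrite lee_fin mulr_ge0// addr_ge0.
  by apply: integral_ge0 => x _; rewrite lee_fin sqr_ge0.
have [ip|] := boolP (\int[m]_x (p x ^+ 2)%:E < +oo)%E; last first.
  rewrite -leNgt leye_eq => /eqP ->; rewrite gt0_muley ?leey// lte_fin.
  by rewrite mulr_gt0// ltr_wpDl.
have Lp : p \in sqint by apply/sqintP.
rewrite -EFin_Rintegral; last exact: Lfun2_integrable_sqr.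
rewrite -EFinM lee_fin.
(* This [t] makes [t * M] at most half of [|v|], which is then absorbed on the left. The [+ 1] keeps
   [t] positive when [M = 0]. *)
have t0 : 0 < `|v| / (2 * (M + 1)).
  by rewrite divr_gt0 ?normr_gt0// mulr_gt0// ltr_wpDl.
have := sqint_le_integral_norm mD finD Lp p0 t0.
have vp : (`|v|%:E <= \int[m]_x `|p x|%:E)%E.
  have -> : (`|v|%:E = `| \int[m]_x (p x)%:E |)%E.
    by rewrite -integral_support ?pv// => x Dx; rewrite p0.
  by apply: le_abse_integral => //; exact/measurable_EFinP.
move=> /(le_trans vp); rewrite lee_fin -/M; set A := \int[m]_x _.
rewrite -(real_normK (num_real v)).
have w0 : 0 < `|v| by rewrite normr_gt0.
move: (`|v|) w0 => w w0 H.
have H1 : w <= A * (2 * (M + 1)) / w + w / 2.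
  apply: (le_trans H); rewrite lerD//.
    by rewrite invf_div mulrA.
  rewrite -mulrA ler_pM2l// mulrC ler_pdivrMr; first by lra.
  by rewrite mulr_gt0// ltr_wpDl.
have : w / 2 <= A * (2 * (M + 1)) / w by lra.
rewrite ler_pdivlMr// expr2; lra.
Qed.

Lemma ae_normr_restrict f : {ae m, forall x, D x -> 0 <= f x} ->
  {ae m, forall x, `|(f \_ D) x| = (f \_ D) x}.
Proof.
apply: filterS => x f0; rewrite patchE; case: ifPn => [/set_mem Dx|_].
  by rewrite ger0_norm ?f0.
by rewrite normr0.
Qed.

End one_space.

(** * Normalising an almost everywhere nonnegative function by its mass *)

Section normalisation.
Context (d : measure_display) (T : measurableType d) (R : realType).
Variables (m : {measure set T -> \bar R}) (D : set T) (f : T -> R) (M : R).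
Hypotheses (mf : measurable_fun setT (f \_ D)).
Hypothesis f0 : {ae m, forall x, D x -> 0 <= f x}.

Lemma integral_normr_restrict :
  (\int[m]_(x in D) (f x)%:E = \int[m]_x `|(f \_ D) x|%:E)%E.
Proof.
rewrite integral_mkcond (_ : _ \_ D = EFin \o (f \_ D)); last first.
  by apply/funext => x /=; rewrite !patchE; case: ifP.
apply: ae_eq_integral => //; first exact/measurable_EFinP.
  by apply/measurable_EFinP; exact: measurableT_comp.
by apply: filterS (ae_normr_restrict f0) => x /= -> _.
Qed.

(* For [M = 0] division yields [0], which is then [f] almost everywhere. *)
Lemma ae_normalise : (\int[m]_(x in D) (f x)%:E = M%:E)%E ->
  {ae m, forall x, D x -> `|(f \_ D) x| / M * M = f x}.
Proof.
rewrite integral_normr_restrict => intf.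
have [M0|M0] := eqVneq M 0; last first.
  apply: filterS (ae_normr_restrict f0) => x -> Dx.
  by rewrite divfK// patchE mem_set.
have mf' : measurable_fun setT (EFin \o (f \_ D)) by exact/measurable_EFinP.
have /(ae_eq_integral_abs m measurableT mf') :
    (\int[m]_x `|(EFin \o (f \_ D)) x| = 0)%E by move: intf; rewrite M0.
apply: filterS => x /(_ I) /= [] + Dx.
by rewrite patchE mem_set// => ->; rewrite normr0 !mul0r.
Qed.

End normalisation.

(** * Properties that a marginal inherits from its plan *)

Section marginal.
Context (d1 d2 : measure_display) (T1 : measurableType d1)
  (T2 : measurableType d2) (R : realType).
Variables (m1 : {measure set T1 -> \bar R}) (m2 : {measure set T2 -> \bar R}).
Variables (D1 : set T1) (D2 : set T2).
Hypotheses (mD1 : measurable D1) (mD2 : measurable D2) (finD2 : (m2 D2 < +oo)%E).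
Variables (P : T1 -> T2 -> R) (mu : T1 -> R).
Hypothesis mP : forall x, measurable_fun setT (P x).
Hypothesis P0 : forall x y, ~ D2 y -> P x y = 0.
Hypothesis Pmu : {ae m1, forall x, D1 x ->
  (\int[m2]_(y in D2) (P x y)%:E = (mu x)%:E)%E}.

(** [sqr_integral_le] on almost every section, then integration in [x]. The plan is curried so that
    both marginals are instances, with the variables swapped. *)
Lemma marginal_L2 : measurable_fun D1 mu ->
  measurable_fun setT (fun x => \int[m2]_y (P x y ^+ 2)%:E)%E ->
  (\int[m1]_x \int[m2]_y (P x y ^+ 2)%:E < +oo)%E -> L2 m1 D1 mu.
Proof.
move=> mmu mF finF; apply/sqintP; split; first exact/(measurable_restrictT mu mD1).
set c := 4 * (fine (m2 D2) + 1).
have c0 : 0 <= c by rewrite mulr_ge0// addr_ge0// fine_ge0.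
have F0 x : (0 <= \int[m2]_y (P x y ^+ 2)%:E)%E.
  by apply: integral_ge0 => y _; rewrite lee_fin sqr_ge0.
apply: (@le_lt_trans _ _ (\int[m1]_x (c%:E * \int[m2]_y (P x y ^+ 2)%:E))%E).
  apply: ae_ge0_le_integral => //.
  - by move=> x _; rewrite lee_fin sqr_ge0.
  - by apply/measurable_EFinP/measurable_funX; exact/(measurable_restrictT mu mD1).
  - by move=> x _; rewrite mule_ge0.
  - by apply: emeasurable_funM.
  apply: filterS Pmu => x Pmux _; rewrite patchE; case: ifPn => [/set_mem Dx|_].
    exact: sqr_integral_le (mP x) (P0 x) (Pmux Dx).
  by rewrite expr0n/= mule_ge0.
by rewrite ge0_integralZl// lte_mul_pinfty.
Qed.

(** The nonnegative [|P| - P] has double integral 0, so on almost every section it vanishes almost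
    everywhere, and there [mu x] is the integral of [|P x y|]. *)
Lemma marginal_ge0 :
  measurable_fun setT (fun x => \int[m2]_y (`|P x y| - P x y)%:E)%E ->
  (\int[m1]_x \int[m2]_y (`|P x y| - P x y)%:E = 0)%E ->
  {ae m1, forall x, D1 x -> 0 <= mu x}.
Proof.
move=> mH intH.
have H0 x y : 0 <= `|P x y| - P x y by rewrite subr_ge0 ler_norm.
have mHx x : measurable_fun setT (fun y => (`|P x y| - P x y)%:E).
  by apply/measurable_EFinP/measurable_funB => //; exact: measurableT_comp.
have /(ae_eq_integral_abs m1 measurableT mH) :
    (\int[m1]_x `|\int[m2]_y (`|P x y| - P x y)%:E| = 0)%E.
  rewrite -intH; apply: eq_integral => x _; rewrite gee0_abs//.
  by apply: integral_ge0 => y _; rewrite lee_fin.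
apply: filterS2 Pmu => x Pmux Hx Dx.
rewrite -lee_fin -Pmux// integral_support; last by move=> y Dy; rewrite P0.
have /(ae_eq_integral_abs m2 measurableT (mHx x)) :
    (\int[m2]_y `|(`|P x y| - P x y)%:E| = 0)%E.
  rewrite -[RHS](Hx I); apply: eq_integral => y _.
  by rewrite abse_EFin ger0_norm.
move=> PE; rewrite (@ae_eq_integral _ _ _ m2 setT (fun y => `|P x y|%:E))//.
- by apply: integral_ge0 => y _; rewrite lee_fin.
- exact/measurable_EFinP.
- by apply/measurable_EFinP; exact: measurableT_comp.
- apply: filterS PE => y /(_ I) /= [] /subr0_eq -> _.
  by [].
Qed.

End marginal.

(** * Plans with prescribed marginals on a product of measure spaces *)

Section transport.
Context (d1 d2 : measure_display) (T1 : measurableType d1)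
  (T2 : measurableType d2) (R : realType).
Variables (m1 : {sigma_finite_measure set T1 -> \bar R})
  (m2 : {sigma_finite_measure set T2 -> \bar R}).
Variables (D1 : set T1) (D2 : set T2).
Hypotheses (mD1 : measurable D1) (mD2 : measurable D2).
Hypotheses (finD1 : (m1 D1 < +oo)%E) (finD2 : (m2 D2 < +oo)%E).
Variables (mu1 : T1 -> R) (mu2 : T2 -> R).
Implicit Types (p q : T1 * T2 -> R).
Local Notation D := (D1 `*` D2).
Local Notation l := (m1 \x m2)%E.

(** This is [feasible] with abstract sigma-finite measures; for Lebesgue measures the two agree by
    conversion. *)
Definition coupling p : Prop :=
  [/\ L2 l D p,
      {ae m1, forall x1, D1 x1 ->
        (\int[m2]_(x2 in D2) (p (x1, x2))%:E = (mu1 x1)%:E)%E},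
      {ae m2, forall x2, D2 x2 ->
        (\int[m1]_(x1 in D1) (p (x1, x2))%:E = (mu2 x2)%:E)%E} &
      {ae l, forall z, D z -> 0 <= p z}].

(** Representatives that vanish off [D], for which integrals over a domain equal integrals over the
    whole space. *)
Definition supported_coupling p := coupling p /\ forall z, ~ D z -> p z = 0.

Let mD : measurable D. Proof. exact: measurableX. Qed.

Let finD : (l D < +oo)%E.
Proof. by rewrite product_measure1E// lte_mul_pinfty// ge0_fin_numE. Qed.

Lemma restrict_support p : (forall z, ~ D z -> p z = 0) -> p \_ D = p.
Proof.
move=> p0; apply/funext => z; rewrite patchE; case: ifPn => // /negP zD.
by rewrite p0// => /mem_set.
Qed.

Lemma supported_couplingP p : (forall z, ~ D z -> p z = 0) ->
  [/\ p \in Lfun l 2%:E,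
      {ae m1, forall x1, D1 x1 ->
        (\int[m2]_(x2 in D2) (p (x1, x2))%:E = (mu1 x1)%:E)%E},
      {ae m2, forall x2, D2 x2 ->
        (\int[m1]_(x1 in D1) (p (x1, x2))%:E = (mu2 x2)%:E)%E} &
      {ae l, forall z, 0 <= p z}] <-> supported_coupling p.
Proof.
move=> p0; split=> [[Lp p1 p2 pge]|[[Lp p1 p2 pge] _]].
  split=> //; split=> //; first by rewrite /L2 restrict_support.
  by apply: filterS pge.
rewrite /L2 restrict_support// in Lp; split=> //.
apply: filterS pge => z pz; have [/pz//|/p0->//] := pselect (D z).
Qed.

Lemma restrict_coupling p : coupling p -> supported_coupling (p \_ D).
Proof.
move=> [Lp p1 p2 pge].
have p0 z : ~ D z -> (p \_ D) z = 0.
  by move=> Dz; rewrite patchE memNset.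
split=> //; split=> //.
- by rewrite /L2 (restrict_support p0).
- apply: filterS p1 => x1 + D1x => /(_ D1x) <-; apply: eq_integral => x2.
  by move=> /set_mem D2x; rewrite patchE mem_set.
- apply: filterS p2 => x2 + D2x => /(_ D2x) <-; apply: eq_integral => x1.
  by move=> /set_mem D1x; rewrite patchE mem_set.
- by apply: filterS pge => z + Dz => /(_ Dz); rewrite patchE mem_set.
Qed.

Let sections_integrable (g : T1 * T2 -> \bar R) : l.-integrable setT g ->
  {ae m1, forall x, m2.-integrable setT (fun y => g (x, y))} /\
  {ae m2, forall y, m1.-integrable setT (fun x => g (x, y))}.
Proof. by move=> ig; split; [exact: ae_integrable1|exact: ae_integrable2]. Qed.

Let coupling_integrable p : supported_coupling p ->
  l.-integrable setT (EFin \o p).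
Proof.
move=> Kp; have [+ p0] := Kp; move=> [Lp _ _ _].
by apply: (sqint_integrable mD finD) => //; rewrite /L2 restrict_support in Lp.
Qed.

(** By Fubini almost every section of both plans is integrable, and there the marginal integral is
    linear. *)
Lemma coupling_midpoint p q : supported_coupling p -> supported_coupling q ->
  supported_coupling (fun z => 2^-1 * (p z + q z)).
Proof.
move=> Kp Kq; have [ip1 ip2] := sections_integrable (coupling_integrable Kp).
have [iq1 iq2] := sections_integrable (coupling_integrable Kq).
have [_ p0] := Kp; have [_ q0] := Kq.
have [Lp p1 p2 pge] := (supported_couplingP p0).2 Kp.
have [Lq q1 q2 qge] := (supported_couplingP q0).2 Kq.
apply/supported_couplingP; first by move=> z Dz; rewrite p0// q0// addr0 mulr0.
split.
- exact/sqintZ/sqintD.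
- near=> x => D1x; apply: integral_midpoint => //.
  + by near: x.
  + by near: x.
  + by move: D1x; near: x.
  + by move: D1x; near: x.
- near=> y => D2y; apply: (@integral_midpoint _ _ _ m1 D1 mD1
    (fun x => p (x, y)) (fun x => q (x, y))) => //.
  + by near: y.
  + by near: y.
  + by move: D2y; near: y.
  + by move: D2y; near: y.
- by apply: filterS2 pge qge => z pz qz; rewrite mulr_ge0// addr_ge0.
Unshelve. all: by end_near. Qed.

(** Almost every section of [g] is integrable, so dominated convergence applies section by section
    to integrals that do not depend on [n]. *)
Lemma coupling_dominated_lim (q_ : nat -> T1 * T2 -> R) q
    (g : T1 * T2 -> \bar R) : (forall n, supported_coupling (q_ n)) ->
  l.-integrable setT g -> (forall z n, (`|q_ n z|%:E <= g z)%E) ->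
  (forall z, (g z < +oo)%E -> q_ ^~ z @ \oo --> q z) ->
  q \in Lfun l 2%:E -> (forall z, ~ D z -> q z = 0) -> supported_coupling q.
Proof.
move=> Kq ig qg qcvg Lq q0.
have [ig1 ig2] := sections_integrable ig.
have Kq' n := (supported_couplingP (Kq n).2).2 (Kq n).
have mq_ n : measurable_fun setT (q_ n).
  by have [/sqint_measurable] := Kq' n.
have mq := sqint_measurable Lq.
apply/supported_couplingP => //; split=> //.
(* A countable union of null sets gives one exceptional set that serves all [n]. *)
- have : {ae m1, forall x1 n, D1 x1 ->
      (\int[m2]_(x2 in D2) (q_ n (x1, x2))%:E = (mu1 x1)%:E)%E}.
    by apply/ae_foralln => n; have [] := Kq' n.
  apply: filterS2 ig1 => x igx qx D1x.
  apply: (@integral_dominated_lim _ _ _ m2 D2 mD2 (fun n y => q_ n (x, y))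
    _ (fun y => g (x, y))) => //.
  + by move=> n; exact: measurableT_comp.
  + exact: measurableT_comp.
  + by move=> y; exact: qcvg.
  + by move=> n; exact: qx.
- have : {ae m2, forall x2 n, D2 x2 ->
      (\int[m1]_(x1 in D1) (q_ n (x1, x2))%:E = (mu2 x2)%:E)%E}.
    by apply/ae_foralln => n; have [] := Kq' n.
  apply: filterS2 ig2 => y igy qy D2y.
  apply: (@integral_dominated_lim _ _ _ m1 D1 mD1 (fun n x => q_ n (x, y))
    _ (fun x => g (x, y))) => //.
  + by move=> n; exact: measurableT_comp.
  + exact: measurableT_comp.
  + by move=> x; exact: qcvg.
  + by move=> n; exact: qy.
- have : {ae l, forall z n, 0 <= q_ n z}.
    by apply/ae_foralln => n; have [] := Kq' n.
  apply: filterS2 (integrable_ae measurableT ig) => z /(_ I) gz qz.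
  have gz' : (g z < +oo)%E by move: gz; rewrite fin_numElt => /andP[].
  by apply: (cvgr_to_ge (qcvg z gz')); exact: nearW.
Qed.

(** * The quadratic objective and the existence of a minimizer *)

Section objective.
Variables (c : T1 * T2 -> R) (gamma : R).
Hypotheses (Lc : L2 l D c) (gamma0 : 0 < gamma).

Definition cost p : R :=
  \int[l]_(z in D) (c z * p z) + gamma / 2 * L2norm l D p ^+ 2.

(** The point to be projected: the unconstrained minimizer of the objective. *)
Let f z := - gamma^-1 * (c \_ D) z.

Let Lf : f \in Lfun l 2%:E. Proof. exact: sqintZ. Qed.

(** Completing the square in [c * p + gamma / 2 * p ^+ 2]; the subtracted term does not depend on
    [p]. *)
Lemma costE p : L2 l D p ->
  cost p = gamma / 2 * \int[l]_z (((p \_ D) z - f z) ^+ 2)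
           - gamma / 2 * \int[l]_z (f z ^+ 2).
Proof.
move=> Lp; rewrite /cost /L2norm sqr_Lnorm2// Rintegral_mkcond.
have -> : \int[l]_z ((fun z => c z * p z) \_ D) z =
    \int[l]_z ((c \_ D) z * (p \_ D) z).
  apply: eq_Rintegral => z _; rewrite !patchE.
  by case: ifPn => //; rewrite mul0r.
have i1 := sqintM Lc Lp.
have i2 := Lfun2_integrable_sqr Lp.
have i3 := Lfun2_integrable_sqr Lf.
have i4 := Lfun2_integrable_sqr (sqintB Lp Lf).
rewrite -!RintegralZl// -RintegralD//; [|exact: integrableZ_EFin].
rewrite -RintegralB//; [|exact: integrableZ_EFin..].
apply: eq_Rintegral => z _; rewrite /f; field.
by rewrite gt_eqF.
Qed.

Lemma exists_min_cost : (exists p, coupling p) ->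
  exists p, coupling p /\ forall q, coupling q -> cost p <= cost q.
Proof.
move=> [p0 cp0].
have f0 z : ~ D z -> f z = 0 by move=> Dz; rewrite /f patchE memNset// mulr0.
have LK p : supported_coupling p -> p \in Lfun l 2%:E.
  by move=> Kp; have [] := (supported_couplingP Kp.2).2 Kp.
have [q_ [g [q [Kq ig qg qcvg [Lq q0 qmin]]]]] := sqint_projection mD finD Lf f0
  (ex_intro _ _ (restrict_coupling cp0)) LK (fun p z Kp => Kp.2 z)
  coupling_midpoint.
have Kq0 := coupling_dominated_lim Kq ig qg qcvg Lq q0.
exists q; split=> [|p cp]; first exact: Kq0.1.
have [Lp _ _ _] := cp; have [Lq' _ _ _] := Kq0.1.
rewrite !costE// lerD2r ler_pM2l ?divr_gt0// restrict_support//.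
by apply: qmin; exact: restrict_coupling.
Qed.

End objective.

(** Tonelli for the nonnegative functions [p ^+ 2] and [|p| - p] supplies the measurable section
    integrals that [marginal_L2] and [marginal_ge0] ask for. *)
Lemma coupling_marginals : measurable_fun D1 mu1 -> measurable_fun D2 mu2 ->
  (exists p, coupling p) ->
  [/\ L2 m1 D1 mu1, L2 m2 D2 mu2,
      {ae m1, forall x, D1 x -> 0 <= mu1 x},
      {ae m2, forall x, D2 x -> 0 <= mu2 x} &
      (\int[m1]_(x in D1) (mu1 x)%:E = \int[m2]_(x in D2) (mu2 x)%:E)%E].
Proof.
move=> mmu1 mmu2 [p' /restrict_coupling Kp]; move: (p' \_ _) Kp => {p'} p Kp.
have p0 := Kp.2; have [Lp p1 p2 pge] := (supported_couplingP p0).2 Kp.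
have ip := coupling_integrable Kp.
have mp := sqint_measurable Lp.
have mp1 x : measurable_fun setT (fun y => p (x, y)) by exact: measurableT_comp.
have mp2 y : measurable_fun setT (fun x => p (x, y)) by exact: measurableT_comp.
have p01 x y : ~ D1 x -> p (x, y) = 0 by move=> Dx; apply: p0 => -[].
have p02 x y : ~ D2 y -> p (x, y) = 0 by move=> Dy; apply: p0 => -[].
have [_ finp] := (sqintP _ _).1 Lp.
have msq : measurable_fun setT (fun z => (p z ^+ 2)%:E).
  by apply/measurable_EFinP; exact: measurable_funX.
have sq0 z : (0 <= (p z ^+ 2)%:E)%E by rewrite lee_fin sqr_ge0.
have mH : measurable_fun setT (fun z => (`|p z| - p z)%:E).
  by apply/measurable_EFinP/measurable_funB => //; exact: measurableT_comp.
have H0 z : (0 <= (`|p z| - p z)%:E)%E by rewrite lee_fin subr_ge0 ler_norm.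
have intH : (\int[l]_z (`|p z| - p z)%:E = 0)%E.
  rewrite (ae_eq_integral (cst 0%E))//; first exact: integral0.
  by apply: filterS pge => z pz _ /=; rewrite ger0_norm// subrr.
split.
- apply: (marginal_L2 (P := fun x y => p (x, y)) mD1 mD2 finD2 mp1 p02 p1 mmu1).
    exact: measurable_fun_fubini_tonelli_F _ msq sq0.
  by have := finp; rewrite (fubini_tonelli1 _ msq sq0).
- apply: (marginal_L2 (P := fun y x => p (x, y)) mD2 mD1 finD1 mp2
    (fun y x => @p01 x y) p2 mmu2).
    exact: measurable_fun_fubini_tonelli_G _ msq sq0.
  by have := finp; rewrite (fubini_tonelli2 _ msq sq0).
- apply: (marginal_ge0 (P := fun x y => p (x, y)) mp1 p02 p1).
    exact: measurable_fun_fubini_tonelli_F _ mH H0.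
  by rewrite -[RHS]intH (fubini_tonelli1 _ mH H0).
- apply: (marginal_ge0 (P := fun y x => p (x, y)) mp2 (fun y x => @p01 x y) p2).
    exact: measurable_fun_fubini_tonelli_G _ mH H0.
  by rewrite -[RHS]intH (fubini_tonelli2 _ mH H0).
(* Both masses are iterated integrals of [p], which Fubini exchanges. *)
- have -> : (\int[m1]_(x in D1) (mu1 x)%:E = \int[m1]_x \int[m2]_y (p (x, y))%:E)%E.
    rewrite -(integral_support m1 (D := D1)); last first.
      by move=> x Dx; apply: integral0_eq => y _; rewrite p01.
    apply: ae_eq_integral => //; first exact/measurable_EFinP.
      exact: measurable_funS (measurable_fubini_F ip).
    apply: filterS p1 => x p1x Dx; rewrite -p1x// integral_support//.
    by move=> y Dy; rewrite p02.
  have -> : (\int[m2]_(y in D2) (mu2 y)%:E = \int[m2]_y \int[m1]_x (p (x, y))%:E)%E.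
    rewrite -(integral_support m2 (D := D2)); last first.
      by move=> y Dy; apply: integral0_eq => x _; rewrite p02.
    apply: ae_eq_integral => //; first exact/measurable_EFinP.
      exact: measurable_funS (measurable_fubini_G ip).
    apply: filterS p2 => y p2y Dy; rewrite -p2y// integral_support//.
    by move=> x Dx; rewrite p01.
  exact: Fubini ip.
Qed.

Lemma product_coupling : L2 m1 D1 mu1 -> L2 m2 D2 mu2 ->
  {ae m1, forall x, D1 x -> 0 <= mu1 x} ->
  {ae m2, forall x, D2 x -> 0 <= mu2 x} ->
  (\int[m1]_(x in D1) (mu1 x)%:E = \int[m2]_(x in D2) (mu2 x)%:E)%E ->
  exists p, coupling p.
Proof.
move=> L1 L2' mu10 mu20 mu12.
pose h1 := mu1 \_ D1; pose h2 := mu2 \_ D2.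
have h10 x : ~ D1 x -> h1 x = 0 by move=> Dx; rewrite /h1 patchE memNset.
have h20 x : ~ D2 x -> h2 x = 0 by move=> Dx; rewrite /h2 patchE memNset.
have mh1 : measurable_fun setT h1 := sqint_measurable L1.
have mh2 : measurable_fun setT h2 := sqint_measurable L2'.
have ih1 : (\int[m1]_x `|h1 x|%:E < +oo)%E.
  by have /integrableP[] := sqint_integrable mD1 finD1 L1 h10.
have [M intM1] : exists M, (\int[m1]_x `|h1 x|%:E = M%:E)%E.
  exists (fine (\int[m1]_x `|h1 x|%:E)%E); rewrite fineK// ge0_fin_numE//.
  by apply: integral_ge0 => x _; rewrite lee_fin.
have M0 : 0 <= M.
  by rewrite -lee_fin -intM1; apply: integral_ge0 => x _; rewrite lee_fin.
have muM1 : (\int[m1]_(x in D1) (mu1 x)%:E = M%:E)%E.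
  by rewrite (integral_normr_restrict mh1 mu10).
have muM2 : (\int[m2]_(x in D2) (mu2 x)%:E = M%:E)%E by rewrite -mu12.
have intM2 : (\int[m2]_x `|h2 x|%:E = M%:E)%E.
  by rewrite -muM2 (integral_normr_restrict mh2 mu20).
have mn1 : measurable_fun setT (fun x => `|h1 x|) by exact: measurableT_comp.
have mn2 : measurable_fun setT (fun x => `|h2 x|) by exact: measurableT_comp.
(* The absolute values make [p] nonnegative everywhere, not just almost everywhere. For [M = 0]
   division yields [p = 0]. *)
pose p (z : T1 * T2) := `|h1 z.1| * `|h2 z.2| / M.
have mp : measurable_fun setT p.
  apply: measurable_funM => //; apply: measurable_funM.
    exact: (measurableT_comp mn1 measurable_fst).
  exact: (measurableT_comp mn2 measurable_snd).
have p_ge0 z : 0 <= p z by rewrite !mulr_ge0// invr_ge0.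
have p0 z : ~ D z -> p z = 0.
  rewrite /p => /not_andP[/h10|/h20] ->; rewrite normr0 ?mul0r ?mulr0 ?mul0r//.
exists p; suff [] : supported_coupling p by [].
apply/(supported_couplingP p0); split.
- apply/sqintP; split => //.
  rewrite fubini_tonelli1; last 2 first.
  + by apply/measurable_EFinP; exact: measurable_funX.
  + by move=> z; rewrite lee_fin sqr_ge0.
  have [_ sq1] := (sqintP _ _).1 L1; have [_ sq2] := (sqintP _ _).1 L2'.
  (* The square of [p] factorises, which reduces its integral to the square integrals of [h1] and
     [h2]. *)
  have E x : fubini_F m2 (fun z => (p z ^+ 2)%:E) x =
      ((M^-1 ^+ 2)%:E * \int[m2]_y (h2 y ^+ 2)%:E * (h1 x ^+ 2)%:E)%E.
    rewrite muleAC -ge0_integralZl//; last 3 first.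
    + by apply/measurable_EFinP; exact: measurable_funX.
    + by move=> y _; rewrite lee_fin sqr_ge0.
    + by rewrite mule_ge0// lee_fin sqr_ge0.
    apply: eq_integral => y _; rewrite -!EFinM /p/= !exprMn.
    by rewrite !real_normK ?num_real// exprVn; congr EFin; ring.
  under eq_integral do rewrite E.
  have c0 : (0 <= (M^-1 ^+ 2)%:E * \int[m2]_y (h2 y ^+ 2)%:E)%E.
    rewrite mule_ge0 ?lee_fin ?sqr_ge0//.
    by apply: integral_ge0 => y _; rewrite lee_fin sqr_ge0.
  rewrite ge0_integralZl//; last 2 first.
  + by apply/measurable_EFinP; exact: measurable_funX.
  + by move=> y _; rewrite lee_fin sqr_ge0.
  rewrite lte_mul_pinfty// ge0_fin_numE// lte_mul_pinfty//.
  by rewrite lee_fin sqr_ge0.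
(* Integrating out the second variable gives [|h1 x| / M * M], since [|h2|] also has integral
   [M]. *)
- apply: filterS (ae_normalise mh1 mu10 muM1) => x hx D1x.
  rewrite integral_support; last by move=> y Dy; rewrite p0// => -[].
  rewrite -hx// [RHS]EFinM -intM2 -ge0_integralZl//; last 2 first.
  + exact/measurable_EFinP.
  + by rewrite lee_fin divr_ge0.
  by apply: eq_integral => y _; rewrite -EFinM /p/= mulrAC.
- apply: filterS (ae_normalise mh2 mu20 muM2) => y hy D2y.
  rewrite integral_support; last by move=> x Dx; rewrite p0// => -[].
  rewrite -hy// [RHS]EFinM -intM1 -ge0_integralZl//; last 2 first.
  + exact/measurable_EFinP.
  + by rewrite lee_fin divr_ge0.
  by apply: eq_integral => x _; rewrite -EFinM /p/= -mulrA mulrC.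
- exact: aeW.
Qed.

End transport.

(** * Specialisation to Lebesgue measure on compact domains *)

Theorem lemma2p1 (R : realType) (d1 d2 : nat)
    (Om1 : set 'rV[R]_d1) (Om2 : set 'rV[R]_d2)
    (hOm1 : compact_domain Om1) (hOm2 : compact_domain Om2)
    (c : 'rV[R]_d1 * 'rV[R]_d2 -> R)
    (hc : L2 (lebesgue R d1 \x lebesgue R d2)%E (Om1 `*` Om2) c)
    (gamma : R) (hgamma : 0 < gamma)
    (mu1 : 'rV[R]_d1 -> R) (mu2 : 'rV[R]_d2 -> R)
    (hmu1 : @measurable_fun _ _ (lebesgue_space R d1) R Om1 mu1)
    (hmu2 : @measurable_fun _ _ (lebesgue_space R d2) R Om2 mu2) :
  (exists p, optimal Om1 Om2 c gamma mu1 mu2 p) <->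
  [/\ L2 (lebesgue R d1) Om1 mu1, L2 (lebesgue R d2) Om2 mu2,
      {ae lebesgue R d1, forall x, Om1 x -> 0 <= mu1 x},
      {ae lebesgue R d2, forall x, Om2 x -> 0 <= mu2 x} &
      (\int[lebesgue R d1]_(x in Om1) (mu1 x)%:E
        = \int[lebesgue R d2]_(x in Om2) (mu2 x)%:E)%E].
Proof.
have [[c1 _] [c2 _]] := (hOm1, hOm2).
have m1 := compact_lebesgue_measurable c1.
have m2 := compact_lebesgue_measurable c2.
have fin1 := compact_lebesgue_lty c1.
have fin2 := compact_lebesgue_lty c2.
split=> [[p [feas_p _]]|[L21 L22 mu1_ge0 mu2_ge0 mass]].
  exact: (coupling_marginals m1 m2 fin1 fin2 hmu1 hmu2 (ex_intro _ p feas_p)).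
(* [optimal] unfolds to the conclusion of [exists_min_cost], with [feasible] for [coupling] and
   [objective] for [cost]. *)
apply: (exists_min_cost m1 m2 fin1 fin2 hc hgamma).
exact: product_coupling.
Qed.
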